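(* Let $m$ be a positive integer and let $x_1\le x_2\le\cdots\le x_{2m}$ be any board of $2m$ real numbers (not necessarily distinct). Then Alice cannot win the game of football on this board; that is, Alice has no strategy that guarantees, against every play of Bob, that the sum of the $m$ elements she holds at the end of the game is strictly larger than the sum of the $m$ elements Bob holds at the end of the game.
   Context: The game of football is a two-player perfect-information game played by Alice and Bob on a board of $2m$ real numbers (equal numbers count as distinct elements of the board). On each turn one player is the picker and the other is the chooser: the picker names an element still on the board, and the chooser removes that element from the board and gives it to a player of their choice (either Alice or Bob). On the first turn Alice is the picker and Bob is the chooser, and the two players switch roles after each turn. The game stops as soon as one player has received $m$ elements, at which point the other player receives all the remaining elements. Thus both players end the game with $m$ elements. The player whose elements have the (strictly) larger sum wins; if the sums are equal, neither player wins. *)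

(* Defs.v *)
From HB Require Import structures.
From mathcomp Require Import all_boot all_order all_algebra.
From mathcomp Require Import reals.

Set Implicit Arguments.
Unset Strict Implicit.
Unset Printing Implicit Defensive.

Import Order.TTheory GRing.Theory Num.Theory.

Local Open Scope ring_scope.

Variant player := Alice | Bob.

Definition is_alice (p : player) : bool := if p is Alice then true else false.

Lemma is_aliceK : cancel is_alice (fun b : bool => if b then Alice else Bob).
Proof. by case. Qed.

HB.instance Definition _ := Equality.copy player (can_type is_aliceK).

(* The elements of the board are the indices of the 2m numbers, so that equal
   numbers count as distinct elements. *)
Notation element m := 'I_(2 * m)%N.

(* The turns played so far, in chronological order: the element removed from
   the board and the player who received it. *)
Definition history (m : nat) := seq (element m * player).

Definition picker (m : nat) (h : history m) : player :=
  if odd (size h) then Bob else Alice.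

Definition on_board (m : nat) (h : history m) : {set element m} :=
  [set i | i \notin [seq mv.1 | mv <- h]].

Definition received (m : nat) (h : history m) (p : player) : {set element m} :=
  [set i | (i, p) \in h].

Definition game_over (m : nat) (h : history m) : bool :=
  (#|received h Alice| == m) || (#|received h Bob| == m).

(* Only meaningful when the game is over; a player who has not received m
   elements gets all those left on the board. *)
Definition final_holding (m : nat) (h : history m) (p : player) :
    {set element m} :=
  if #|received h p| == m then received h p else received h p :|: on_board h.

(* A strategy may depend on the whole history; as chooser, a player also
   knows the element that the opponent has just named. *)
Record strategy (m : nat) := Strategy {
  pick : history m -> element m;
  choose : history m -> element m -> player
}.

(* The (possibly unfinished) plays in which Alice follows s and Bob moves
   arbitrarily within the rules. *)
Inductive play_against (m : nat) (s : strategy m) : history m -> Prop :=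
| play_start : play_against s [::]
| play_alice_picks (h : history m) (p : player) :
    play_against s h -> ~~ game_over h -> picker h = Alice ->
    play_against s (rcons h (pick s h, p))
| play_bob_picks (h : history m) (i : element m) :
    play_against s h -> ~~ game_over h -> picker h = Bob ->
    i \in on_board h ->
    play_against s (rcons h (i, choose s h i)).

(* Without this condition an Alice strategy could name elements that are no
   longer on the board. *)
Definition legal_strategy (m : nat) (s : strategy m) : Prop :=
  forall h : history m, play_against s h -> ~~ game_over h ->
    picker h = Alice -> pick s h \in on_board h.

Definition alice_wins (R : realType) (m : nat) (x : element m -> R)
    (h : history m) : Prop :=
  \sum_(i in final_holding h Bob) x i < \sum_(i in final_holding h Alice) x i.

Definition winning_strategy (R : realType) (m : nat) (x : element m -> R)
    (s : strategy m) : Prop :=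
  legal_strategy s /\
  forall h : history m, play_against s h -> game_over h -> alice_wins x h.

Definition alice_can_win (R : realType) (m : nat) (x : element m -> R) : Prop :=
  exists s : strategy m, winning_strategy x s.

(* Main.v *)
Require Import Defs.
From mathcomp Require Import all_boot all_order all_algebra.
From mathcomp Require Import reals.
From mathcomp Require Import zify ring lra.

(** Write V_p(S, a) for the largest total that Alice can force for herself on
    the elements of a board S when she is to receive exactly [a] of them (Bob
    receiving the others) and the player p names the next element.  The proof
    rests on two comparisons of V_Alice and V_Bob which hold for every real
    board and every [a]:
    - if #|S| is odd then V_Bob(S, a) <= V_Alice(S, a);
    - if #|S| is even then V_Alice(S, a) <= V_Bob(S, a).
    Suppose that on the initial board, where #|S| = 2m and a = m, Alice could get
    more than half of the total.  By the second comparison she could still do so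
    if Bob were the first picker.  But then Bob would be in the position that
    Alice had at first and could do the same, so that both players would get
    more than half, which is absurd ([can_exceed_dual]).

    The odd case ([bob_to_alice_picks]) holds because Alice can name the median
    e of S: neither way of assigning e hurts her, that is,
      V_Bob(S, a) <= x_e + V_Bob(S - e, a - 1) and
      V_Bob(S, a) <= V_Bob(S - e, a).
    These are instances of a more general bound ([removal_bound]): an element e
    may be deleted from a board S + e and given to Alice, without the turn
    passing, if at least half of the elements of S (rounded down) are below e
    and Bob is the one who names the last but one element of S; the case of e
    given to Bob is the same with all signs changed ([can_exceed_opp]).  This
    bound and the odd case are proved by a simultaneous induction on the size of
    the board.  When Bob picks, Alice's answers on S + e are copied.  When Alice
    picks on S + e and names an element above e, she names it on S as well; if
    she names e or an element i below e, then i can be traded for e, which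
    reduces the claim to V_Bob(S, a) <= V_Alice(S, a), where #|S| is odd.

    The even case ([alice_to_bob_picks]) follows from the odd one: if naming i
    is good for Alice, then for any j named by Bob she takes j when x_j >= x_i
    and leaves it to Bob otherwise, because i and j may then be exchanged
    ([can_exceed_exchange]). *)

Set Implicit Arguments.
Unset Strict Implicit.
Unset Printing Implicit Defensive.

Import Order.TTheory GRing.Theory Num.Theory.

Local Open Scope ring_scope.

(** * The value of a position *)

(** [can_exceed x k p S a c]: on the board [S] of [k] elements, of which Alice
    is still to receive exactly [a] and Bob the other [k - a], Alice can force
    the total of the elements of [S] that she receives to be larger than [c].
    She names the next element if [p] is true, and Bob does otherwise.  In the
    notation above this is c < V_p(S, a); working with thresholds avoids maxima
    and minima over sets.  The value [false] is never reached. *)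
Fixpoint can_exceed (R : realDomainType) (T : finType) (x : T -> R) (k : nat)
    (p : bool) (S : {set T}) (a : nat) (c : R) : bool :=
  if a == 0%N then c < 0
  else if (k <= a)%N then c < \sum_(i in S) x i
  else if k isn't k'.+1 then false
  else if p then
    [exists i in S, can_exceed x k' false (S :\ i) a.-1 (c - x i)
                 && can_exceed x k' false (S :\ i) a c]
  else
    [forall i in S, can_exceed x k' true (S :\ i) a.-1 (c - x i)
                 || can_exceed x k' true (S :\ i) a c].

Lemma can_exceed0 (R : realDomainType) (T : finType)
    (x : T -> R) (k : nat) (p : bool) (S : {set T}) (c : R) :
  can_exceed x k p S 0 c = (c < 0).
Proof. by case: k. Qed.

Lemma can_exceed_all (R : realDomainType) (T : finType)
    (x : T -> R) (k : nat) (p : bool) (S : {set T}) (c : R) : #|S| = k ->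
  can_exceed x k p S k c = (c < \sum_(i in S) x i).
Proof.
move=> Sk; case: k Sk => [|k] Sk /=; last by rewrite leqnn.
by move/eqP: Sk; rewrite cards_eq0 => /eqP ->; rewrite big_set0.
Qed.

Lemma can_exceedAP (R : realDomainType) (T : finType)
    (x : T -> R) (k : nat) (S : {set T}) (a : nat) (c : R) : (0 < a <= k)%N ->
  reflect (exists2 i, i \in S & can_exceed x k false (S :\ i) a.-1 (c - x i)
                             /\ can_exceed x k false (S :\ i) a c)
          (can_exceed x k.+1 true S a c).
Proof.
case/andP=> a_gt0 ak /=; rewrite gtn_eqF // ltnNge ak /=.
apply: (iffP exists_inP) => -[i iS]; first by case/andP; exists i.
by case=> *; exists i => //; apply/andP.
Qed.

Lemma can_exceedBP (R : realDomainType) (T : finType)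
    (x : T -> R) (k : nat) (S : {set T}) (a : nat) (c : R) : (0 < a <= k)%N ->
  reflect (forall i, i \in S -> can_exceed x k true (S :\ i) a.-1 (c - x i)
                             \/ can_exceed x k true (S :\ i) a c)
          (can_exceed x k.+1 false S a c).
Proof.
case/andP=> a_gt0 ak /=; rewrite gtn_eqF // ltnNge ak /=.
apply: (iffP forall_inP) => H i /H; first by move/orP.
by move=> ?; apply/orP.
Qed.

Lemma cardD1k (T : finType)
    (k : nat) (S : {set T}) (i : T) : i \in S -> #|S| = k.+1 -> #|S :\ i| = k.
Proof. by move=> iS; rewrite (cardsD1 i) iS => -[]. Qed.

Lemma can_exceed_le (R : realDomainType) (T : finType)
    (x : T -> R) (k : nat) (p : bool) (S : {set T}) (a : nat) (c c' : R) :
  c' <= c -> can_exceed x k p S a c -> can_exceed x k p S a c'.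
Proof.
elim: k p S a c c' => [|k IH] p S a c c' lec /=.
  by case: ifP => _; apply: le_lt_trans.
case: ifP => _; first exact: le_lt_trans.
case: ifP => _; first exact: le_lt_trans.
case: p.
  case/exists_inP=> i iS /andP[H1 H2]; apply/exists_inP; exists i => //.
  by rewrite (IH _ _ _ _ _ _ H1) ?lerB // (IH _ _ _ _ _ _ H2).
move/forall_inP=> H; apply/forall_inP => i /H /orP[] /IH -> //;
  by rewrite ?lerB ?orbT.
Qed.

(** If x_d <= x_e, replacing d by e on the board does not hurt Alice, and Alice
    holding e with d on the board is at least as good for her as Alice holding d
    with e on the board. *)
Lemma can_exceed_exchange (R : realDomainType) (T : finType)
    (x : T -> R) (k : nat) (p : bool) (S : {set T}) (d e : T) (a : nat) (c : R) :
    #|S| = k -> d \notin S -> e \notin S -> x d <= x e ->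
  (can_exceed x k.+1 p (d |: S) a c -> can_exceed x k.+1 p (e |: S) a c) /\
  (can_exceed x k.+1 p (e |: S) a (c - x d) ->
   can_exceed x k.+1 p (d |: S) a (c - x e)).
Proof.
elim: k p S a c => [|k IH] p S a c Sk dS eS lede.
  case: a => [|a] /=; first by split=> //; lra.
  by rewrite !big_setU1 //=; split; lra.
have [->|a_gt0] := posnP a; first by rewrite !can_exceed0; split; lra.
have [ak|ak] := leqP k.+2 a.
  by rewrite /= gtn_eqF // ak !big_setU1 //=; split; lra.
have aP : (0 < a <= k.+1)%N by rewrite a_gt0.
have comm f i : i \in S -> f \notin S -> (f |: S) :\ i = f |: (S :\ i).
  move=> iS fS; apply/setP=> j; rewrite !inE.
  by case: (eqVneq j f) => [->|_] //=; case: eqP fS => // ->; rewrite iS.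
have rem f : f \notin S -> (f |: S) :\ f = S by move=> fS; rewrite setU1K.
have subS f i : f \notin S -> f \notin S :\ i.
  by rewrite in_setD1 => /negPf ->; rewrite andbF.
have IHi i b c' : i \in S -> _ := fun iS => IH (~~ p) (S :\ i) b c'
  (cardD1k iS Sk) (subS d i dS) (subS e i eS) lede.
case: p IHi => /= IHi; split.
- case/can_exceedAP=> // i; rewrite in_setU1 => /orP[/eqP-> | iS] [].
    rewrite rem // => H1 H2; apply/can_exceedAP => //; exists e; rewrite ?setU11 //.
    by rewrite rem //; split=> //; apply: can_exceed_le H1; lra.
  rewrite comm // => H1 H2; apply/can_exceedAP => //.
  exists i; first by rewrite setU1r.
  by rewrite comm //; split; apply IHi.
- case/can_exceedAP=> // i; rewrite in_setU1 => /orP[/eqP-> | iS] [].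
    rewrite rem // => H1 H2; apply/can_exceedAP => //; exists d; rewrite ?setU11 //.
    by rewrite rem //; split; [apply: can_exceed_le H1|apply: can_exceed_le H2]; lra.
  rewrite comm // => H1 H2; apply/can_exceedAP => //.
  exists i; first by rewrite setU1r.
  rewrite comm //; split; last by apply IHi.
  by rewrite addrAC; apply IHi => //; rewrite addrAC.
- move/can_exceedBP=> H; apply/can_exceedBP => // i; rewrite in_setU1.
  case/orP=> [/eqP-> | iS].
    have := H aP d (setU11 _ _); rewrite !rem //.
    case=> H1; [left; apply: can_exceed_le H1; lra|by right].
  have := H aP i (setU1r _ iS); rewrite !comm //.
  by case=> H1; [left|right]; apply IHi.
- move/can_exceedBP=> H; apply/can_exceedBP => // i; rewrite in_setU1.
  case/orP=> [/eqP-> | iS].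
    have := H aP e (setU11 _ _); rewrite !rem //.
    by case=> H1; [left|right]; apply: can_exceed_le H1; lra.
  have := H aP i (setU1r _ iS); rewrite !comm //.
  case=> H1; [left|right]; last by apply IHi.
  by rewrite addrAC; apply IHi => //; rewrite addrAC.
Qed.

(** Changing all signs amounts to exchanging the two players as receivers, while
    each of them keeps the turns as picker. *)
Lemma can_exceed_opp (R : realDomainType) (T : finType)
    (x y : T -> R) (k : nat) (p : bool) (S : {set T}) (a : nat) (c : R) :
    (forall i, y i = - x i) -> #|S| = k -> (a <= k)%N ->
  can_exceed x k p S a c ->
  can_exceed y k p S (k - a) (c - \sum_(i in S) x i).
Proof.
move=> yE; have sumy U : \sum_(i in U) y i = - \sum_(i in U) x i.
  by rewrite -sumrN; apply: eq_bigr.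
elim: k p S a c => [|k IH] p S a c Sk ak.
  have -> : a = 0%N by lia.
  rewrite can_exceed0 can_exceed0; move/eqP: Sk.
  by rewrite cards_eq0 => /eqP ->; rewrite big_set0 subr0.
have [->|a_gt0] := posnP a.
  by rewrite can_exceed0 subn0 can_exceed_all // sumy; lra.
have [ak'|ak'] := leqP k.+1 a.
  have -> : a = k.+1 by lia.
  by rewrite can_exceed_all // subnn can_exceed0; lra.
have aP : (0 < a <= k)%N by lia.
have bP : (0 < k.+1 - a <= k)%N by lia.
have E1 i : i \in S -> (k.+1 - a).-1 = (k - a)%N by lia.
have E2 i : i \in S -> (k.+1 - a = k - a.-1)%N by lia.
have sumS i : i \in S -> \sum_(j in S) x j = x i + \sum_(j in S :\ i) x j.
  exact: big_setD1.
have step i : i \in S ->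
    (can_exceed x k (~~ p) (S :\ i) a.-1 (c - x i) ->
     can_exceed y k (~~ p) (S :\ i) (k.+1 - a) (c - \sum_(j in S) x j)) /\
    (can_exceed x k (~~ p) (S :\ i) a c ->
     can_exceed y k (~~ p) (S :\ i) (k.+1 - a).-1 (c - \sum_(j in S) x j - y i)).
  move=> iS; split=> /IH; rewrite (cardD1k iS Sk) => /(_ erefl).
    rewrite (E2 i) // (sumS i) // opprD addrA; apply; lia.
  rewrite (E1 i) // (sumS i) // yE.
  have -> : c - (x i + \sum_(j in S :\ i) x j) - - x i
            = c - \sum_(j in S :\ i) x j by ring.
  by apply; lia.
case: p step => /= step.
  case/can_exceedAP=> // i iS [/(step i iS).1 H1 /(step i iS).2 H2].
  by apply/can_exceedAP => //; exists i.
move/can_exceedBP=> H; apply/can_exceedBP => // i iS.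
by case: (H aP i iS) => [/(step i iS).1|/(step i iS).2]; [right|left].
Qed.

(** Exchanging the two players altogether: the last hypothesis says that Bob,
    who is to receive [k - a] elements, can get more than the total of [S] minus
    [c], which is incompatible with Alice getting more than [c]. *)
Lemma can_exceed_dual (R : realDomainType) (T : finType)
    (x : T -> R) (k : nat) (p : bool) (S : {set T}) (a : nat) (c : R) :
    #|S| = k -> (a <= k)%N ->
  can_exceed x k p S a c ->
  can_exceed x k (~~ p) S (k - a) (\sum_(i in S) x i - c) -> False.
Proof.
elim: k p S a c => [|k IH] p S a c Sk ak.
  have -> : a = 0%N by lia.
  rewrite !can_exceed0; move/eqP: Sk.
  by rewrite cards_eq0 => /eqP ->; rewrite big_set0; lra.
have [->|a_gt0] := posnP a.
  by rewrite can_exceed0 subn0 can_exceed_all //; lra.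
have [ak'|ak'] := leqP k.+1 a.
  have -> : a = k.+1 by lia.
  by rewrite can_exceed_all // subnn can_exceed0; lra.
have aP : (0 < a <= k)%N by lia.
have bP : (0 < k.+1 - a <= k)%N by lia.
have step q i : i \in S ->
    (can_exceed x k q (S :\ i) a.-1 (c - x i) ->
     can_exceed x k (~~ q) (S :\ i) (k.+1 - a) (\sum_(j in S) x j - c) ->
     False) /\
    (can_exceed x k q (S :\ i) a c ->
     can_exceed x k (~~ q) (S :\ i) (k.+1 - a).-1 (\sum_(j in S) x j - c - x i) ->
     False).
  move=> iS; rewrite (big_setD1 i) //=; split=> H1 H2.
    apply: (IH _ _ _ _ (cardD1k iS Sk) _ H1); first lia.
    have -> : (k - a.-1 = k.+1 - a)%N by lia.
    by apply: can_exceed_le H2; lra.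
  apply: (IH _ _ _ _ (cardD1k iS Sk) _ H1); first lia.
  have -> : (k - a = (k.+1 - a).-1)%N by lia.
  by apply: can_exceed_le H2; lra.
case: p.
  case/can_exceedAP=> // i iS [H1 H2] /can_exceedBP-/(_ bP i iS).
  by case; [apply: (step false i iS).2|apply: (step false i iS).1].
move=> /can_exceedBP H; case/can_exceedAP=> // i iS [H1 H2].
by case: (H aP i iS) => H3; [apply: (step true i iS).1 H3 _
                           |apply: (step true i iS).2 H3 _].
Qed.

Arguments can_exceed : simpl never.

(** * Medians *)

(** The elements of [S] whose value is at most that of [e]. *)
Definition low (R : realDomainType) (T : finType) (x : T -> R) (S : {set T})
  (e : T) : {set T} := [set i in S | x i <= x e].

(** With [y = - x], the set [low y (S :\ e) e] consists of the elements of value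
    at least x_e, so that [e] is a median of [S]. *)
Lemma exists_median (R : realDomainType) (T : finType) (x y : T -> R)
    (S : {set T}) (k : nat) :
    (forall i, y i = - x i) -> #|S| = k.+1 -> ~~ odd k ->
  exists e, [/\ e \in S, (k./2 <= #|low x (S :\ e) e|)%N
               & (k./2 <= #|low y (S :\ e) e|)%N].
Proof.
move=> yE Sk ek.
have /card_gt0P[i0 i0S] : (0 < #|S|)%N by rewrite Sk.
case: (arg_maxP (P := mem S) x i0S) => m inS mmax.
have {inS}mS : m \in S := inS.
pose P e := (e \in S) && (k./2 <= #|low x (S :\ e) e|)%N.
have Pm : P m.
  rewrite /P mS /low; suff -> : [set i in S :\ m | x i <= x m] = S :\ m.
    by rewrite (cardD1k mS Sk); lia.
  by apply/setP=> i; rewrite inE; case iS: (i \in S :\ m) => //=;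
     apply: mmax; case/setD1P: iS.
(* The smallest element with at least k/2 elements below it is a median. *)
case: (arg_minP x Pm) => e /andP[eS le_e] emin; exists e; split=> //.
rewrite leqNgt; apply/negP=> gt_e.
pose D := [set i in S | x i < x e].
have Dcard : (#|D| + #|low y (S :\ e) e| = k)%N.
  rewrite -(cardD1k eS Sk) -(cardsID D (S :\ e)); congr (_ + _)%N.
    by apply: eq_card => i; rewrite !inE; case: eqVneq => [->|_] //=;
       rewrite ?ltxx ?andbF // andbA andbb.
  apply: eq_card => i; rewrite !inE !yE lerN2 leNgt.
  by case: (i == e); case: (i \in S) => //=; rewrite ?andbF ?andbT.
have k2 : (k = k./2 + k./2)%N by rewrite addnn even_halfK.
have /card_gt0P[j0 j0D] : (0 < #|D|)%N by lia.
case: (arg_maxP (P := mem D) x j0D) => j inD jmax.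
have {inD}jD : j \in D := inD.
have /[!inE]/andP[jS lt_je] := jD.
suff /emin : P j by rewrite leNgt lt_je.
rewrite /P jS /=.
suff sub : D :\ j \subset low x (S :\ j) j.
  apply: leq_trans (subset_leq_card sub).
  have := cardsD1 j D; rewrite jD; lia.
apply/subsetP=> i; rewrite !inE => /and3P[ij iS ie].
rewrite ij iS /=; apply: jmax.
by change (i \in D); rewrite inE iS.
Qed.

Lemma lowD1 (R : realDomainType) (T : finType) (x : T -> R)
    (S : {set T}) (e i : T) :
  (#|low x S e| <= (x i <= x e)%R + #|low x (S :\ i) e|)%N.
Proof.
rewrite (cardsD1 i) leq_add //.
  by rewrite inE; case: (i \in S) => //=; rewrite leq0n.
by apply/subset_leq_card/subsetP=> j; rewrite !inE andbA.
Qed.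

(** * Comparing the two possible pickers *)

(** In the notation above, V_p(S + e, a + 1) <= x_e + V_p(S, a) whenever at least
    [k./2] elements of [S] are below [e].  Here [k = #|S|], and the picker is
    Alice exactly when [k] is odd: with this parity Bob names the last but one
    element of [S], and [k./2] is the number of elements of [S] that he names
    before the last one, whose owner is forced. *)
Definition removal_bound (R : realDomainType) (T : finType) (k : nat) :=
  forall (x : T -> R) (S : {set T}) (e : T) (a : nat) (c : R),
    #|S| = k -> e \notin S -> (a <= k)%N -> (k./2 <= #|low x S e|)%N ->
    can_exceed x k.+1 (odd k) (e |: S) a.+1 c ->
    can_exceed x k (odd k) S a (c - x e).

(** On an odd board, picking first is not worse for Alice than choosing first. *)
Lemma bob_to_alice_picks (R : realDomainType) (T : finType) (x : T -> R)
    (k : nat) (S : {set T}) (a : nat) (c : R) :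
    removal_bound R T k -> ~~ odd k -> #|S| = k.+1 -> (a <= k.+1)%N ->
  can_exceed x k.+1 false S a c -> can_exceed x k.+1 true S a c.
Proof.
move=> bnd ek Sk ak.
have [->|a_gt0] := posnP a; first by rewrite !can_exceed0.
have [ka|ak'] := ltnP k a.
  have -> : a = k.+1 by lia.
  by rewrite !can_exceed_all.
have aP : (0 < a <= k)%N by lia.
pose y i := - x i.
(* Alice names a median. *)
have [e [eS lowe highe]] := @exists_median _ _ x y _ _ (fun=> erefl) Sk ek.
have eN : e \notin S :\ e by rewrite setD11.
have S'k := cardD1k eS Sk.
have sumE : \sum_(i in S) x i = x e + \sum_(i in S :\ e) x i by apply: big_setD1.
move=> H; apply/can_exceedAP => //; exists e => //; split.
  have := bnd x (S :\ e) e a.-1 c S'k eN.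
  by rewrite (negPf ek) setD1K // prednK //; apply=> //; lia.
(* The case of e given to Bob is the case of e given to Alice for the values
   [- x]. *)
have := @can_exceed_opp _ _ x y _ _ _ _ c (fun=> erefl) Sk ak H.
have -> : (k.+1 - a = (k - a).+1)%N by lia.
have := bnd y (S :\ e) e (k - a)%N (c - \sum_(i in S) x i) S'k eN
  (leq_subr _ _) highe.
rewrite setD1K // (negPf ek) => bnd' /bnd' /(@can_exceed_opp _ _ y x).
move=> /(_ (fun i => esym (opprK (x i))) S'k (leq_subr _ _)).
rewrite subKn; last lia.
have -> : c - \sum_(i in S) x i - y e - \sum_(i in S :\ e) y i = c.
  by rewrite sumE sumrN /y; ring.
by [].
Qed.

Lemma removal_bound_holds (R : realDomainType) (T : finType) (k : nat) :
  removal_bound R T k.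
Proof.
elim: k => [|k IH] x S e a c Sk eS ak lowe.
  have -> : a = 0%N by lia.
  have /eqP := Sk; rewrite cards_eq0 => /eqP ->.
  by rewrite setU0 can_exceed0 can_exceed_all ?cards1 // big_set1 subr_lt0.
have [ka|ak'] := ltnP k a.
  have -> : a = k.+1 by lia.
  rewrite !can_exceed_all ?cardsU1 ?eS ?Sk //.
  by rewrite big_setU1 //= ltrBlDl.
have aP : (0 < a.+1 <= k.+1)%N by lia.
have comm i : i \in S -> (e |: S) :\ i = e |: (S :\ i).
  move=> iS; apply/setP=> j; rewrite !inE.
  by case: (eqVneq j e) => [->|_] //=; case: eqP eS => // ->; rewrite iS.
have eSi i : e \notin S :\ i by rewrite !inE negb_and eS orbT.
have [ok|ek] := boolP (odd k); rewrite oddS ?ok ?(negPf ek) /=.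
- (* Bob picks: Alice answers as she would on e |: S. *)
  move/can_exceedBP => H.
  have low_i i : i \in S -> (k./2 <= #|low x (S :\ i) e|)%N.
    have := lowD1 x S e i; have := leq_b1 (x i <= x e); lia.
  have IHi i b c' : i \in S -> (b <= k)%N ->
      can_exceed x k.+1 true ((e |: S) :\ i) b.+1 c' ->
      can_exceed x k true (S :\ i) b (c' - x e).
    move=> iS bk; rewrite comm //; have := IH x (S :\ i) e b c'.
    by rewrite ok; apply=> //; [exact: cardD1k|exact: low_i].
  have [a0|a_gt0] := posnP a.
    rewrite a0 can_exceed0.
    (* Alice receives only one element of e |: S; if Bob names some i below e,
       taking it gives her at most x_e. *)
    have /card_gt0P[i] : (0 < #|low x S e|)%N by lia.
    rewrite inE => /andP[iS le_ie].
    case: (H aP i (setU1r _ iS)); rewrite a0.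
      by rewrite can_exceed0; lra.
    by move/(IHi _ _ _ iS); rewrite can_exceed0; apply.
  apply/can_exceedBP => [|i iS]; first by rewrite a_gt0.
  case: (H aP i (setU1r _ iS)) => /=; last by move/(IHi _ _ _ iS) => ?; right; auto.
  rewrite -{1}(prednK a_gt0) => /(IHi _ _ _ iS) H1; left.
  by rewrite addrAC; apply: H1; lia.
- (* Alice picks. *)
  case/can_exceedAP => // i /=.
  have toA c' : can_exceed x k.+1 false S a c' -> can_exceed x k.+1 true S a c'.
    by apply: bob_to_alice_picks => //; lia.
  rewrite in_setU1 => /orP[/eqP->|iS] [].
    by rewrite setU1K // => /toA.
  rewrite comm //.
  have [le_ie|lt_ei] := leP (x i) (x e).
    have := (@can_exceed_exchange _ _ x k false (S :\ i) i e a c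
      (cardD1k iS Sk) _ (eSi i) le_ie).2.
    by rewrite setD11 setD1K // => /(_ isT) H1 /H1 /toA.
  have IHi b c' : (b <= k)%N ->
      can_exceed x k.+1 false (e |: (S :\ i)) b.+1 c' ->
      can_exceed x k false (S :\ i) b (c' - x e).
    move=> bk; have := IH x (S :\ i) e b c'; rewrite (negPf ek).
    apply=> //; first exact: cardD1k.
    by have := lowD1 x S e i; rewrite leNgt lt_ei /=; lia.
  have [->|a_gt0] := posnP a.
    by move=> _ /IHi; rewrite !can_exceed0; apply.
  move=> H1 /IHi H2; apply/can_exceedAP; first by rewrite a_gt0.
  exists i => //; split; last exact: H2.
  move: H1; rewrite -{1}(prednK a_gt0) => /IHi H1.
  by rewrite addrAC; apply: H1; lia.
Qed.

(** On an even board, choosing first is not worse for Alice than picking first. *)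
Lemma alice_to_bob_picks (R : realDomainType) (T : finType) (x : T -> R)
    (k : nat) (S : {set T}) (a : nat) (c : R) :
    ~~ odd k -> #|S| = k -> (a <= k)%N ->
  can_exceed x k true S a c -> can_exceed x k false S a c.
Proof.
case: k => [//|k] ek Sk ak.
have [->|a_gt0] := posnP a; first by rewrite !can_exceed0.
have [ka|ak'] := ltnP k a.
  have -> : a = k.+1 by lia.
  by rewrite !can_exceed_all.
have aP : (0 < a <= k)%N by lia.
case: k ek Sk {ak} ak' aP => [|k] ek Sk ak aP; first by lia.
have toA (U : {set T}) b c' : #|U| = k.+1 -> (b <= k.+1)%N ->
    can_exceed x k.+1 false U b c' -> can_exceed x k.+1 true U b c'.
  by apply: bob_to_alice_picks; [exact: removal_bound_holds|rewrite -oddS; lia].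
case/can_exceedAP => // i iS [/toA H1 /toA H2].
have {}H1 := H1 (cardD1k iS Sk) _; have {}H2 := H2 (cardD1k iS Sk) ak.
apply/can_exceedBP => // j jS.
have [->|ij] := eqVneq j i; first by right.
have iSj : i \in S :\ j by rewrite !inE eq_sym ij.
have jSi : j \in S :\ i by rewrite !inE ij.
have E : S :\ i :\ j = S :\ j :\ i by rewrite !setDDl setUC.
have exch := @can_exceed_exchange _ _ x k true (S :\ i :\ j).
have cardU := cardD1k jSi (cardD1k iS Sk).
have iN : i \notin S :\ i :\ j by rewrite !inE eqxx /= andbF.
have jN : j \notin S :\ i :\ j by rewrite setD11.
have [le_ij|lt_ji] := leP (x i) (x j).
  left; have := (exch i j a.-1 c cardU iN jN le_ij).2.
  by rewrite setD1K // E setD1K //; apply; apply: H1; lia.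
right; have := (exch j i a c cardU jN iN (ltW lt_ji)).1.
by rewrite setD1K // E setD1K //; apply.
Qed.

(** * Plays *)

Lemma on_board_nil (m : nat) : on_board [::] = [set: element m].
Proof. by apply/setP=> i; rewrite !inE. Qed.

Lemma received_nil (m : nat) (p : player) :
  received [::] p = set0 :> {set element m}.
Proof. by apply/setP=> i; rewrite !inE. Qed.

Lemma on_board_rcons (m : nat) (h : history m) (i : element m) (p : player) :
  on_board (rcons h (i, p)) = on_board h :\ i.
Proof.
by apply/setP=> j; rewrite !inE map_rcons mem_rcons in_cons negb_or.
Qed.

Lemma received_rcons (m : nat) (h : history m) (i : element m) (p q : player) :
  received (rcons h (i, p)) q =
    if p == q then i |: received h q else received h q.
Proof.
apply/setP=> j; rewrite inE mem_rcons in_cons xpair_eqE.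
by case: (eqVneq p q) => _; rewrite !inE ?andbT ?andbF.
Qed.

Lemma on_board_received (m : nat) (h : history m) (p : player) (i : element m) :
  i \in on_board h -> i \notin received h p.
Proof.
by rewrite !inE; apply: contra => ih; apply/mapP; exists (i, p).
Qed.

(** Induction on plays, forgetting which strategy makes the moves. *)
Lemma play_ind_on_board (m : nat) (s : strategy m) (P : history m -> Prop) :
    legal_strategy s ->
    P [::] ->
    (forall h i p, play_against s h -> P h -> ~~ game_over h ->
       i \in on_board h -> P (rcons h (i, p))) ->
  forall h, play_against s h -> P h.
Proof.
move=> legal P0 PS h; elim=> [//|{}h p sh Ph over Ap|{}h i sh Ph over Bp ih].
  by apply: PS => //; exact: legal.
exact: PS.
Qed.

(** The elements received by either player and those on the board partition the
    initial board. *)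
Lemma big_play (m : nat) (s : strategy m) (V : Type) (idx : V)
    (op : Monoid.com_law idx) (F : element m -> V) (h : history m) :
    legal_strategy s -> play_against s h ->
  op (op (\big[op/idx]_(i in received h Alice) F i)
         (\big[op/idx]_(i in received h Bob) F i))
     (\big[op/idx]_(i in on_board h) F i) = \big[op/idx]_i F i.
Proof.
move=> legal; move: h; apply: (play_ind_on_board legal).
  rewrite !received_nil on_board_nil !big_set0 !Monoid.mul1m.
  by apply: eq_bigl => i; rewrite inE.
move=> h i p _ IH _ ih; rewrite on_board_rcons !received_rcons -IH.
rewrite (big_setD1 i ih) /=.
have moveA u a b d : op (op (op u a) b) d = op (op a b) (op u d).
  by rewrite (Monoid.mulmC op u a) (Monoid.mulmAC op a u b) -(Monoid.mulmA op).
have moveB u a b d : op (op a (op u b)) d = op (op a b) (op u d).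
  by rewrite (Monoid.mulmC op u b) !(Monoid.mulmA op).
by case: p => /=; rewrite big_setU1 ?on_board_received.
Qed.

Lemma card_play (m : nat) (s : strategy m) (h : history m) :
    legal_strategy s -> play_against s h ->
  [/\ #|received h Alice| <= m, #|received h Bob| <= m
    & #|received h Alice| + #|received h Bob| + #|on_board h| = 2 * m]%N.
Proof.
move=> legal sh.
have := big_play addn (fun=> 1%N) legal sh.
rewrite !sum1_card card_ord => cardh.
suff le_m q : (#|received h q| <= m)%N by split.
move: {cardh} h sh; apply: (play_ind_on_board legal).
  by rewrite received_nil cards0.
move=> h i p _ le_m over ih; rewrite received_rcons.
case: (p == q) => //; rewrite cardsU1 on_board_received //.
rewrite ltn_neqAle le_m andbT; move: over; rewrite negb_or => /andP[].
by case: q {le_m}.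
Qed.

(** If Alice has a winning strategy, then in every play that follows it she can
    still reach more than half of the total. *)
Lemma winning_can_exceed (R : realType) (m : nat) (x : element m -> R)
    (s : strategy m) (h : history m) :
    winning_strategy x s -> play_against s h ->
  can_exceed x #|on_board h| (~~ odd (size h)) (on_board h)
    (m - #|received h Alice|)
    ((\sum_i x i) / 2 - \sum_(i in received h Alice) x i).
Proof.
case=> legal wins; have [k] := ubnP #|on_board h|.
elim: k h => // k IH h ltk sh.
have [leA leB card_h] := card_play legal sh.
have /= sum_h := big_play +%R x legal sh.
have disj p : [disjoint received h p & on_board h].
  rewrite disjoint_sym; apply/pred0P=> i; apply/negP => /andP[ih].
  exact/negP/on_board_received.
have sum_rest p : \sum_(i in received h p :|: on_board h) x i
    = \sum_(i in received h p) x i + \sum_(i in on_board h) x i.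
  by rewrite -bigU //; apply: eq_bigl => i; rewrite in_setU.
have [over|] := boolP (game_over h).
  have := wins h sh over; rewrite /alice_wins /final_holding.
  have [A_m|A_m] := eqVneq #|received h Alice| m.
    rewrite A_m subnn can_exceed0.
    have -> : \sum_(i in (if #|received h Bob| == m then received h Bob
        else received h Bob :|: on_board h)) x i
      = \sum_(i in received h Bob) x i + \sum_(i in on_board h) x i.
      case: eqP => [B_m|_]; last by rewrite sum_rest.
      suff -> : on_board h = set0 by rewrite big_set0 addr0.
      by apply/eqP; rewrite -cards_eq0; lia.
    by rewrite /=; lra.
  have B_m : #|received h Bob| = m.
    by move: over; rewrite /game_over (negPf A_m) => /eqP.
  rewrite B_m eqxx sum_rest.
  have -> : (m - #|received h Alice| = #|on_board h|)%N by lia.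
  by rewrite can_exceed_all //; lra.
rewrite negb_or => /andP[A_m B_m].
have over : ~~ game_over h by rewrite negb_or A_m.
have : (0 < m - #|received h Alice| <= #|on_board h|.-1)%N by lia.
case Ek : #|on_board h| ltk => [|k'] ltk aP; first by lia.
have next i p : i \in on_board h -> play_against s (rcons h (i, p)) ->
    can_exceed x k' (odd (size h)) (on_board h :\ i)
      (if p is Alice then (m - #|received h Alice|).-1
       else (m - #|received h Alice|)%N)
      (if p is Alice
       then (\sum_i x i) / 2 - \sum_(i in received h Alice) x i - x i
       else (\sum_i x i) / 2 - \sum_(i in received h Alice) x i).
  move=> ih sh'; have := IH (rcons h (i, p)).
  rewrite on_board_rcons (cardD1k ih Ek) size_rcons /= negbK => /(_ ltk sh').
  rewrite received_rcons; case: p {sh'} => //=.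
  rewrite big_setU1 ?on_board_received //= cardsU1 on_board_received //=.
  by rewrite addrC opprD addrA addrAC -subnS.
have [odd_h|even_h] := boolP (odd (size h)).
  have Bp : picker h = Bob by rewrite /picker odd_h.
  apply/can_exceedBP => // i ih.
  have := next i (Defs.choose s h i) ih (play_bob_picks sh over Bp ih).
  by rewrite odd_h; case: (Defs.choose s h i); [left|right].
have Ap : picker h = Alice by rewrite /picker (negPf even_h).
have ih := legal h sh over Ap.
apply/can_exceedAP => //; exists (Defs.pick s h) => //.
have := next _ _ ih (play_alice_picks Alice sh over Ap).
have := next _ _ ih (play_alice_picks Bob sh over Ap).
by rewrite (negPf even_h).
Qed.

Theorem theorem1p1 (R : realType) (m : nat) (x : 'I_(2 * m) -> R)
    (m_gt0 : (0 < m)%N)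
    (x_sorted : forall i j : 'I_(2 * m), (i <= j)%N -> x i <= x j) :
  ~ alice_can_win x.
Proof.
case=> s win; have := winning_can_exceed win (play_start s).
rewrite on_board_nil received_nil cards0 big_set0 subn0 subr0 cardsT card_ord /=.
move=> Alice_picks.
have card_T : #|[set: 'I_(2 * m)]| = (2 * m)%N by rewrite cardsT card_ord.
have le_m : (m <= 2 * m)%N by lia.
have Bob_picks : can_exceed x (2 * m) false setT m ((\sum_i x i) / 2).
  by apply: alice_to_bob_picks Alice_picks => //; rewrite oddM.
apply: (can_exceed_dual card_T le_m Alice_picks).
have -> : (2 * m - m = m)%N by lia.
have -> : \sum_(i in [set: 'I_(2 * m)]) x i = \sum_i x i.
  by apply: eq_bigl => i; rewrite inE.
by have -> : \sum_i x i - (\sum_i x i) / 2 = (\sum_i x i) / 2 by lra.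
Qed.
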